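(* Let $p$ be an even integer with $2\le p\le n$, and let $\phi=\{\phi_k: k=1,2,\dots,n\}$ be an $\mathfrak{M}_p$-multiplicative system of real random variables on a probability space such that $\|\phi_k\|_\infty\le 1$ for all $k$. Then for every choice of real coefficients $a_1,\dots,a_n$, $$\left\|\sum_{k=1}^n a_k\phi_k\right\|_p\le K(p)\left(\sum_{k=1}^n a_k^2\right)^{1/2},$$ with the constant $K(p)=((p-1)!!)^{1/p}$.
   Context: $\mathfrak{M}_p$ denotes the family of all nonempty subsets of $\{1,2,\dots,n\}$ of cardinality at most $p$. A system $\phi_1,\dots,\phi_n$ is $\mathfrak{M}_p$-multiplicative if $\mathbf{E}[\phi_{n_1}\phi_{n_2}\cdots\phi_{n_\nu}]=0$ for every $\{n_1,\dots,n_\nu\}\in\mathfrak{M}_p$ (distinct indices). $\|X\|_p=(\mathbf{E}|X|^p)^{1/p}$, and $(p-1)!!=1\cdot3\cdot5\cdots(p-1)$. The constant $((p-1)!!)^{1/p}$ is the known optimal constant in Khintchine's inequality for independent Rademacher random variables when $p$ is an even integer. *)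

(* Defs.v *)
From HB Require Import structures.
From mathcomp Require Import all_boot all_order all_algebra.
From mathcomp Require Import all_classical all_reals all_analysis.

Set Implicit Arguments.
Unset Strict Implicit.
Unset Printing Implicit Defensive.

Import Order.TTheory GRing.Theory Num.Theory.

Local Open Scope ring_scope.

(* Elements of {1, ..., n} are represented by 'I_n = {0, ..., n-1}. *)
Definition small_subsets (n p : nat) : {set {set 'I_n}} :=
  finset (fun A : {set 'I_n} => (A != finset.set0) && (#|A| <= p)%N).

Definition multiplicative_system (d : measure_display) (T : measurableType d)
    (R : realType) (P : probability T R) (n p : nat)
    (phi : 'I_n -> {RV P >-> R}) : Prop :=
  forall A : {set 'I_n}, A \in small_subsets n p ->
    ('E_P[fun w : T => (\prod_(i in A) phi i w)%R] = 0)%E.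

(* m!! = 1 * 3 * 5 * ... * m for m odd. *)
Definition odd_double_factorial (m : nat) : nat :=
  (\prod_(1 <= k < m.+1 | odd k) k)%N.

Definition khintchine_const (R : realType) (p : nat) : R :=
  (odd_double_factorial p.-1)%:R `^ (p%:R)^-1.

(* Main.v *)
Require Import Defs.
From HB Require Import structures.
From mathcomp Require Import all_boot all_order all_algebra.
From mathcomp Require Import all_classical all_reals all_analysis.
From mathcomp Require Import measurable_realfun ess_sup_inf ring lra.

Set Implicit Arguments.
Unset Strict Implicit.
Unset Printing Implicit Defensive.

Import Order.TTheory GRing.Theory Num.Theory.

Local Open Scope ring_scope.

(* Write S(e) = sum_k a_k e_k for a sign vector e.  For x in [-1, 1]^n the
   Riesz weights prod_k (1 + x_k e_k) / 2^n are the law of independent signs with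
   means x_k, so Jensen's inequality bounds (sum_k a_k x_k)^p by the average of
   S^p under this law, a combination of the monomials prod_(k in A) x_k whose
   coefficients are the Walsh coefficients of S^p.  These vanish for #|A| > p,
   since S^p has degree p in e; substituting x = phi and integrating, the
   multiplicativity of phi kills those with 0 < #|A| <= p.  What remains is the
   uniform average of S^p, which the recursion
   E S^(2q+2) <= (2q+1) (sum_k a_k^2) E S^(2q) bounds by the double factorial. *)

(** * Elementary inequalities for powers *)

Lemma exprn_ge_tangent (R : realDomainType) (q : nat) (s t : R) :
  0 <= s -> 0 <= t -> s ^+ q + q%:R * s ^+ q.-1 * (t - s) <= t ^+ q.
Proof.
move=> s0 t0; elim: q => [|[|q] IH]; rewrite ?expr0 ?expr1 /=; [lra|lra|].
have {IH} := ler_wpM2l t0 IH; rewrite -exprS /=; apply: le_trans.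
rewrite -subr_ge0.
have -> : t * (s ^+ q.+1 + q.+1%:R * s ^+ q * (t - s)) -
  (s ^+ q.+2 + q.+2%:R * s ^+ q.+1 * (t - s)) = q.+1%:R * s ^+ q * (t - s) ^+ 2.
  by rewrite !exprS -[q.+2%:R]natr1; ring.
by rewrite mulr_ge0 ?sqr_ge0 // mulr_ge0 ?exprn_ge0 // ler0n.
Qed.

(** Applying [exprn_ge_tangent] to the squares of m and y removes the signs; for p = 2q+2 the
    remaining gap is (q+1) m^(2q) (y-m)^2. This is the supporting line needed for Jensen's
    inequality. *)
Lemma even_exprn_ge_tangent (R : realDomainType) (p : nat) (m y : R) :
  ~~ odd p -> m ^+ p + p%:R * m ^+ p.-1 * (y - m) <= y ^+ p.
Proof.
move=> /even_halfK <-; case: (p./2) => [|q].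
  by rewrite !expr0 !mul0r addr0.
have := exprn_ge_tangent q.+1 (sqr_ge0 m) (sqr_ge0 y).
rewrite -!exprM -!mul2n mulnS; apply: le_trans; rewrite -subr_ge0 /=.
have -> : m ^+ (2 + 2 * q) + q.+1%:R * m ^+ (2 * q) * (y ^+ 2 - m ^+ 2) -
   (m ^+ (2 + 2 * q) + (2 + 2 * q)%:R * m ^+ (1 + 2 * q) * (y - m)) =
   q.+1%:R * m ^+ (2 * q) * (y - m) ^+ 2.
  by rewrite !exprD -mulnS natrM; ring.
by rewrite mulr_ge0 ?sqr_ge0 // mulr_ge0 ?ler0n // exprM exprn_ge0 ?sqr_ge0.
Qed.

(** As i + j is even, y and z may be replaced by their absolute values; then |z|^i - |y|^i and |z|^j
    - |y|^j never have opposite signs. *)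
Lemma exprD_rearrangement (R : realDomainType) (i j : nat) (y z : R) :
  ~~ odd (i + j) ->
  y ^+ j * z ^+ i + y ^+ i * z ^+ j <= y ^+ (i + j) + z ^+ (i + j).
Proof.
move=> ev.
have nrm (x : R) : x ^+ (i + j) = `|x| ^+ (i + j).
  by rewrite -normrX ger0_norm ?exprn_even_ge0.
rewrite (nrm y) (nrm z).
apply: (@le_trans _ _ (`|y| ^+ j * `|z| ^+ i + `|y| ^+ i * `|z| ^+ j)).
  by apply: lerD; rewrite -!normrX -normrM ler_norm.
rewrite -subr_ge0 !exprD.
have -> : `|y| ^+ i * `|y| ^+ j + `|z| ^+ i * `|z| ^+ j -
  (`|y| ^+ j * `|z| ^+ i + `|y| ^+ i * `|z| ^+ j) =
  (`|z| ^+ i - `|y| ^+ i) * (`|z| ^+ j - `|y| ^+ j) by ring.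
have [yz|/ltW yz] := leP `|y| `|z|.
  by rewrite mulr_ge0 // subr_ge0 lerXn2r ?nnegrE.
by rewrite mulr_le0 // subr_le0 lerXn2r ?nnegrE.
Qed.

(** Factor y^m - z^m as (y - z) times a sum of m monomials of degree m-1. Pairing each monomial with
    its mirror image, [exprD_rearrangement] bounds every pair by y^(m-1) + z^(m-1). *)
Lemma trapezoid_exprn (R : realDomainType) (m : nat) (y z : R) : odd m ->
  2 * ((y - z) * (y ^+ m - z ^+ m))
    <= m%:R * (y - z) ^+ 2 * (y ^+ m.-1 + z ^+ m.-1).
Proof.
case: m => [//|m] /= om; rewrite subrXX /= expr2.
have -> T : 2 * ((y - z) * ((y - z) * T)) = (y - z) ^+ 2 * (T + T) :> R by ring.
have -> T : m.+1%:R * ((y - z) * (y - z)) * T = (y - z) ^+ 2 * (T *+ m.+1) :> R.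
  by rewrite -[T *+ _]mulr_natl; ring.
apply: ler_wpM2l; first exact: sqr_ge0.
have -> : (y ^+ m + z ^+ m) *+ m.+1 = \sum_(i < m.+1) (y ^+ m + z ^+ m).
  by rewrite sumr_const card_ord.
rewrite [X in X + _](reindex_inj rev_ord_inj) -big_split /=.
apply: ler_sum => i _; have im : (i <= m)%N by rewrite -ltnS.
rewrite subSS subKn // addrC; have e : (i + (m - i))%N = m by rewrite subnKC.
by have := @exprD_rearrangement R i (m - i)%N y z; rewrite e; apply.
Qed.


(** * Sign vectors and Walsh orthogonality *)

Definition rsign (R : realDomainType) (I : finType) (e : {ffun I -> bool})
  (k : I) : R := (-1) ^+ e k.
Arguments rsign R {I} e k.

Definition rsum (R : realDomainType) (I : finType) (a : I -> R)
  (e : {ffun I -> bool}) : R := \sum_k a k * rsign R e k.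

Definition flip (I : finType) (k : I) (e : {ffun I -> bool}) :
  {ffun I -> bool} := [ffun i => (i == k) (+) e i].

Lemma flipK (I : finType) (k : I) : involutive (flip k).
Proof. by move=> e; apply/ffunP => i; rewrite !ffunE addbA addbb. Qed.

Lemma sum_flip (R : realDomainType) (I : finType) (k : I)
    (F : {ffun I -> bool} -> R) :
  \sum_e F (flip k e) = \sum_e F e.
Proof. by rewrite [RHS](reindex_inj (inv_inj (flipK k))). Qed.

Lemma sum_flip_eq0 (R : realDomainType) (I : finType) (k : I)
    (F : {ffun I -> bool} -> R) :
  (forall e, F (flip k e) = - F e) -> \sum_e F e = 0.
Proof.
move=> FN; have : \sum_e F e = - \sum_e F e.
  by rewrite -[LHS](sum_flip k) -sumrN; apply: eq_bigr => e _; rewrite FN.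
by lra.
Qed.

Lemma rsign_sqr (R : realDomainType) (I : finType) (e : {ffun I -> bool}) k :
  rsign R e k * rsign R e k = 1.
Proof. by rewrite -expr2 sqrr_sign. Qed.

Lemma rsign_flip (R : realDomainType) (I : finType) (e : {ffun I -> bool}) k :
  rsign R (flip k e) k = - rsign R e k.
Proof. by rewrite /rsign ffunE eqxx signrN. Qed.

Lemma rsign_flip_neq (R : realDomainType) (I : finType) (e : {ffun I -> bool})
    (k i : I) : i != k -> rsign R (flip k e) i = rsign R e i.
Proof. by rewrite /rsign ffunE => /negPf ->. Qed.

Lemma rsum_flip (R : realDomainType) (I : finType) (a : I -> R)
    (e : {ffun I -> bool}) (k : I) :
  rsum a (flip k e) = rsum a e - 2 * (a k * rsign R e k).
Proof.
rewrite /rsum (bigD1 k) //= [in RHS](bigD1 k) //= rsign_flip.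
rewrite (eq_bigr (fun i => a i * rsign R e i)); first by ring.
by move=> i ik; rewrite rsign_flip_neq.
Qed.

(** A degree count: each factor of [rsum] multiplies the Walsh monomial of A by some e_k, which adds
    k to A or, as e_k^2 = 1, removes it. So m factors cannot exhaust A, and flipping a surviving
    index cancels the sum. *)
Lemma sum_rsign_rsum_eq0 (R : realDomainType) (I : finType) (a : I -> R)
    (m : nat) (A : {set I}) : (m < #|A|)%N ->
  \sum_e (\prod_(i in A) rsign R e i) * rsum a e ^+ m = 0.
Proof.
elim: m A => [|m IH] A mA.
  have /card_gt0P [k kA] := mA.
  apply: (sum_flip_eq0 (k := k)) => e; rewrite !expr0 !mulr1.
  rewrite (big_setD1 k) //= [in RHS](big_setD1 k) //= rsign_flip mulNr.
  by congr (- (_ * _)); apply: eq_bigr => i; rewrite !inE => /andP[ik _];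
    rewrite rsign_flip_neq.
transitivity (\sum_k a k * \sum_e
  ((\prod_(i in A) rsign R e i) * rsign R e k) * rsum a e ^+ m).
  under [RHS]eq_bigr => k _ do rewrite mulr_sumr.
  rewrite exchange_big; apply: eq_bigr => e _ /=.
  rewrite exprS /rsum mulrA [X in X * _]mulrC mulr_suml mulr_suml.
  by apply: eq_bigr => k _; ring.
rewrite big1 // => k _.
have [kA|kA] := boolP (k \in A).
  rewrite (eq_bigr (fun e => (\prod_(i in A :\ k) rsign R e i)
    * rsum a e ^+ m)).
    by rewrite IH ?mulr0 //; move: mA; rewrite (cardsD1 k A) kA.
  by move=> e _; congr (_ * _); rewrite (big_setD1 k) //= mulrAC rsign_sqr mul1r.
rewrite (eq_bigr (fun e => (\prod_(i in k |: A) rsign R e i)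
  * rsum a e ^+ m)); first by rewrite IH ?mulr0 // cardsU1 kA ltnW // ltnW.
by move=> e _; rewrite big_setU1 //= [X in X * _]mulrC.
Qed.

(** * Riesz weights and Jensen's inequality *)

Lemma sum_rweight (R : realDomainType) (I : finType) (x : I -> R) :
  \sum_(e : {ffun I -> bool}) \prod_i (x i * rsign R e i + 1)
    = #|{ffun I -> bool}|%:R.
Proof.
under eq_bigr do rewrite bigA_distr.
rewrite exchange_big /= (bigD1 finset.set0) //= [X in _ + X]big1 ?addr0.
  rewrite -sumr_const; apply: eq_bigr => e _.
  by rewrite big1 // => i; rewrite inE.
(* The zeroth power stands for 1, so that the degree count applies with m = 0. *)
move=> A A0; transitivity (\prod_(i in A) x i *
  \sum_e (\prod_(i in A) rsign R e i) * rsum x e ^+ 0).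
  rewrite mulr_sumr; apply: eq_bigr => e _.
  by rewrite -big_mkcond big_split expr0 mulr1.
by rewrite sum_rsign_rsum_eq0 ?mulr0 // card_gt0.
Qed.

(** Each e_k has mean x_k under the weights: for s^2 = 1, (1 + x_k s)(s - x_k) = s (1 - x_k^2),
    which is odd in s, so flipping e_k cancels the sum. *)
Lemma sum_rweight_rsum (R : realDomainType) (I : finType) (a x : I -> R) :
  \sum_(e : {ffun I -> bool}) (\prod_i (x i * rsign R e i + 1))
     * (rsum a e - \sum_k a k * x k) = 0.
Proof.
transitivity (\sum_k a k * \sum_(e : {ffun I -> bool})
    (\prod_i (x i * rsign R e i + 1)) * (rsign R e k - x k)).
  under [RHS]eq_bigr => k _ do rewrite mulr_sumr.
  rewrite exchange_big; apply: eq_bigr => e _ /=.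
  rewrite -sumrB mulr_sumr.
  by apply: eq_bigr => k _; ring.
rewrite big1 // => k _; rewrite (sum_flip_eq0 (k := k)) ?mulr0 // => e.
rewrite (bigD1 k) //= [in RHS](bigD1 k) //= rsign_flip.
rewrite (eq_bigr (fun i => x i * rsign R e i + 1)); last first.
  by move=> i ik; rewrite rsign_flip_neq.
set s := rsign R e k; have ss : s * s = 1 by exact: rsign_sqr.
set T := \prod_(i | _) _.
apply/eqP; rewrite -subr_eq0.
have -> : (x k * - s + 1) * T * (- s - x k) -
    - ((x k * s + 1) * T * (s - x k)) =
  2 * x k * T * (s * s - 1) by ring.
by rewrite ss subrr mulr0.
Qed.

(* The right-hand side is the sum over e of S(e)^p prod_k (1 + x_k e_k). *)
Lemma exprn_le_multilinear (R : realDomainType) (I : finType) (a x : I -> R)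
    (p : nat) : ~~ odd p -> (forall k, `|x k| <= 1) ->
  #|{ffun I -> bool}|%:R * (\sum_k a k * x k) ^+ p <=
  \sum_(A : {set I}) (\sum_e (\prod_(i in A) rsign R e i) * rsum a e ^+ p)
    * \prod_(i in A) x i.
Proof.
move=> ep x1; set m := \sum_k a k * x k.
pose w (e : {ffun I -> bool}) := \prod_i (x i * rsign R e i + 1).
have w0 e : 0 <= w e.
  apply: prodr_ge0 => i _; have := x1 i; rewrite ler_norml => /andP[].
  by rewrite /rsign; case: (e i); rewrite ?expr1 ?expr0; lra.
have -> : \sum_(A : {set I}) (\sum_e (\prod_(i in A) rsign R e i)
    * rsum a e ^+ p) * \prod_(i in A) x i = \sum_e w e * rsum a e ^+ p.
  under eq_bigr => A _ do rewrite mulr_suml.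
  rewrite exchange_big; apply: eq_bigr => e _ /=.
  rewrite /w bigA_distr mulr_suml; apply: eq_bigr => A _.
  by rewrite -big_mkcond big_split /=; ring.
(* Jensen's inequality by the tangent at the mean m: the linear term averages to zero. *)
have -> : #|{ffun I -> bool}|%:R * m ^+ p =
    \sum_e w e * (m ^+ p + p%:R * m ^+ p.-1 * (rsum a e - m)).
  under eq_bigr => e _ do rewrite mulrDr mulrCA.
  rewrite big_split /= -mulr_suml -mulr_sumr sum_rweight_rsum sum_rweight.
  by rewrite mulr0 addr0.
by apply: ler_sum => e _; apply: ler_wpM2l => //; exact: even_exprn_ge_tangent.
Qed.

(** * Moments of sign sums *)

(* Gaussian integration by parts for signs: flipping e_k writes the left-hand side
   with (S - S') (S^m - S'^m), which the trapezoid rule for t^(m-1) controls. *)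
Lemma sum_rsign_rsum_le (R : realFieldType) (I : finType) (a : I -> R)
    (m : nat) (k : I) : odd m ->
  a k * \sum_e rsign R e k * rsum a e ^+ m
    <= m%:R * a k ^+ 2 * \sum_e rsum a e ^+ m.-1.
Proof.
move=> om; pose S := rsum a.
(* One factor 2 comes from S - S' = 2 a_k e_k, the other from the flip symmetry exchanging S and
   S'. *)
have L : 4 * (a k * \sum_e rsign R e k * S e ^+ m) =
    \sum_e (S e - S (flip k e)) * (S e ^+ m - S (flip k e) ^+ m).
  under [RHS]eq_bigr => e _ do rewrite mulrBr.
  rewrite big_split /= sumrN.
  rewrite -(sum_flip k (fun e => (S e - S (flip k e)) * S (flip k e) ^+ m)).
  rewrite -sumrN -big_split /= !mulr_sumr; apply: eq_bigr => e _.
  by rewrite flipK /S rsum_flip; ring.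
have H : 2 * (4 * (a k * \sum_e rsign R e k * S e ^+ m)) <=
    \sum_e m%:R * (S e - S (flip k e)) ^+ 2 *
      (S e ^+ m.-1 + S (flip k e) ^+ m.-1).
  by rewrite L mulr_sumr; apply: ler_sum => e _; exact: trapezoid_exprn.
have E : \sum_e m%:R * (S e - S (flip k e)) ^+ 2 *
    (S e ^+ m.-1 + S (flip k e) ^+ m.-1)
   = 8 * (m%:R * a k ^+ 2 * \sum_e S e ^+ m.-1).
  transitivity (\sum_e 4 * (m%:R * a k ^+ 2) *
    (S e ^+ m.-1 + S (flip k e) ^+ m.-1)).
    apply: eq_bigr => e _; congr (_ * _).
    have -> : S e - S (flip k e) = 2 * (a k * rsign R e k).
      by rewrite /S rsum_flip; ring.
    have := rsign_sqr R e k; rewrite -expr2 => ss.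
    by rewrite !exprMn ss; ring.
  by rewrite -mulr_sumr big_split /= (sum_flip k (fun e => S e ^+ m.-1)); ring.
by move: H; rewrite E -/S; lra.
Qed.

(** The bound is the moment of order 2q of a centred Gaussian of variance sum_k a_k^2, up to the
    number of sign vectors. *)
Lemma khintchine_even (R : realFieldType) (I : finType) (a : I -> R) (q : nat) :
  \sum_e rsum a e ^+ q.*2 <= #|{ffun I -> bool}|%:R *
    ((\prod_(0 <= j < q) j.*2.+1)%:R * (\sum_k a k ^+ 2) ^+ q).
Proof.
elim: q => [|q IH].
  by rewrite big_geq // mul1r expr0 mulr1 -sumr_const; apply: ler_sum.
have -> : \sum_e rsum a e ^+ q.+1.*2 =
    \sum_k a k * \sum_e rsign R e k * rsum a e ^+ q.*2.+1.
  under [RHS]eq_bigr => k _ do rewrite mulr_sumr.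
  rewrite exchange_big; apply: eq_bigr => e _ /=.
  rewrite doubleS exprS [X in X * _]/rsum mulr_suml.
  by apply: eq_bigr => k _; rewrite mulrA.
apply: (@le_trans _ _ (\sum_k q.*2.+1%:R * a k ^+ 2 * \sum_e rsum a e ^+ q.*2)).
  by apply: ler_sum => k _; apply: sum_rsign_rsum_le; rewrite /= odd_double.
rewrite -mulr_suml -mulr_sumr.
have s0 : 0 <= q.*2.+1%:R * \sum_k a k ^+ 2.
  by rewrite mulr_ge0 // sumr_ge0 // => k _; exact: sqr_ge0.
apply: le_trans (ler_wpM2l s0 IH) _.
rewrite big_nat_recr //= natrM exprS le_eqVlt; apply/orP; left.
by apply/eqP; ring.
Qed.

Lemma odd_double_factorial_double (q : nat) :
  odd_double_factorial q.*2.-1 = (\prod_(0 <= j < q) j.*2.+1)%N.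
Proof.
case: q => [|q]; first by rewrite /odd_double_factorial !big_geq.
rewrite /odd_double_factorial prednK ?double_gt0 //.
(* Index 0 is even, so adding it is harmless; the range then grows by one even and one odd index per
   step. *)
have odd0 (m : nat) : (0 < m)%N -> (\prod_(1 <= k < m | odd k) k =
    \prod_(0 <= k < m | odd k) k)%N by move=> m0; rewrite [RHS]big_ltn_cond.
rewrite odd0 ?double_gt0 //; elim: q.+1 => [|r IH]; first by rewrite !big_geq.
by rewrite doubleS big_mkcond !big_nat_recr //= odd_double muln1 -big_mkcond IH.
Qed.

(** * Almost sure bounds and integration *)

Lemma ae_bounded_integrable (d : measure_display) (T : measurableType d)
    (R : realType) (P : probability T R) (f : T -> R) (M : R) :
  measurable_fun [set: T] f -> {ae P, forall w, `|f w| <= M} ->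
  P.-integrable [set: T] (EFin \o f).
Proof.
move=> mf fM; apply/integrableP; split; first exact/measurable_EFinP.
apply: (@le_lt_trans _ _ (\int[P]_w (`|M|%:E))%E); last first.
  by rewrite integral_cst //= probability_setT mule1 ltry.
apply: ae_ge0_le_integral => //.
- by apply: measurableT_comp => //; exact/measurable_EFinP.
- by apply: filterS fM => w fM _; rewrite lee_fin (le_trans fM) // ler_norm.
Qed.

Lemma Lnormy_le1_ae (d : measure_display) (T : measurableType d)
    (R : realType) (P : probability T R) (f : T -> R) :
  ('N[P]_(+oo)[EFin \o f] <= 1)%E -> {ae P, forall w, `|f w| <= 1}.
Proof.
(* The norm is an essential supremum only on a space of positive measure, here of measure 1. *)
rewrite unlock /= probability_setT lte01 => /ess_supP.
by apply: filterS => w /=; rewrite lee_fin.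
Qed.
Theorem corollary1p3 (d : measure_display) (T : measurableType d)
    (R : realType) (P : probability T R) (n p : nat)
    (p_even : ~~ odd p) (p_ge2 : (2 <= p)%N) (p_le_n : (p <= n)%N)
    (phi : 'I_n -> {RV P >-> R})
    (phi_mult : multiplicative_system p phi)
    (phi_bounded : forall k : 'I_n, ('N[P]_(+oo)[EFin \o phi k] <= 1)%E)
    (a : 'I_n -> R) :
  ('N[P]_(p%:R%:E)[EFin \o (fun w : T => (\sum_(k < n) a k * phi k w)%R)]
    <= (khintchine_const R p * Num.sqrt (\sum_(k < n) a k ^+ 2))%R%:E)%E.
Proof.
pose q := p./2; have pq : p = q.*2 by rewrite even_halfK.
pose N : R := #|{ffun 'I_n -> bool}|%:R.
have N0 : 0 < N by rewrite ltr0n; apply/card_gt0P; exists [ffun=> true].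
pose S w := \sum_(k < n) a k * phi k w.
pose c (A : {set 'I_n}) := \sum_e (\prod_(i in A) rsign R e i) * rsum a e ^+ p.
pose m (A : {set 'I_n}) w := \prod_(i in A) phi i w.
(* The multilinear majorant of S^p, evaluated at phi. *)
pose Y w := N^-1 * \sum_(A : {set 'I_n}) c A * m A w.
have ae1 : {ae P, forall w, forall k, `|phi k w| <= 1}.
  by apply: filter_forall => k; exact: Lnormy_le1_ae.
have SY : {ae P, forall w, S w ^+ p <= Y w}.
  apply: filterS ae1 => w w1; rewrite /Y ler_pdivlMl //.
  exact: exprn_le_multilinear.
have mS : measurable_fun [set: T] S.
  by apply: measurable_sum => k; apply: measurable_funM.
have mm A : measurable_fun [set: T] (m A).
  rewrite /m; under eq_fun => w do rewrite -big_enum.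
  exact: measurable_prod.
have mY : measurable_fun [set: T] Y.
  apply: measurable_funM => //; apply: measurable_sum => A.
  exact: measurable_funM.
have mi A : P.-integrable [set: T] (EFin \o m A).
  apply: (@ae_bounded_integrable _ _ _ _ _ 1) => //.
  apply: filterS ae1 => w w1; rewrite /m normr_prod.
  by apply: prodr_ile1 => i _; rewrite normr_ge0 w1.
have EY : ('E_P[Y] = (N^-1 * c finset.set0)%:E)%E.
  rewrite unlock.
  have -> : (\int[P]_w (Y w)%:E =
     \int[P]_w (N^-1%:E * \sum_(A : {set 'I_n}) (c A)%:E * (m A w)%:E))%E.
    by apply: eq_integral => w _; rewrite /Y EFinM -sumEFin.
  have mci A : P.-integrable [set: T] (fun w => ((c A)%:E * (m A w)%:E)%E).
    exact: (integrableZl _ _ (mi A)).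
  rewrite integralZl //; last exact: integrable_sum.
  rewrite integral_sum // (bigD1 finset.set0) //= big1 ?adde0.
    rewrite integralZl //; last exact: mi.
    under eq_integral => w do rewrite /m big_set0.
    by rewrite integral_cst //= probability_setT !mule1 EFinM.
  move=> A A0; rewrite integralZl //; last exact: mi.
  (* Small A vanish by multiplicativity of phi, large A by the degree count. *)
  have [Ap|Ap] := leqP #|A| p.
    have : A \in small_subsets n p by rewrite inE A0.
    by move=> /phi_mult; rewrite expectation.unlock => ->; rewrite mule0.
  by rewrite /c sum_rsign_rsum_eq0 // mul0e.
have ES : ('E_P[fun w => (S w ^+ p)%R] <=
   ((odd_double_factorial p.-1)%:R * (\sum_k a k ^+ 2) ^+ q)%:E)%E.
  apply: (@le_trans _ _ 'E_P[Y]%E); last first.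
    rewrite EY lee_fin ler_pdivrMl // pq odd_double_factorial_double.
    have -> : c finset.set0 = \sum_e rsum a e ^+ q.*2.
      by apply: eq_bigr => e _; rewrite big_set0 mul1r pq.
    exact: khintchine_even.
  (* Y is known to be nonnegative only almost surely, so |Y|, which equals it almost everywhere,
     serves in the comparison of nonnegative functions. *)
  apply: (@le_trans _ _ 'E_P[fun w => `|Y w|%R]%E).
    apply: expectation_le => //.
    - exact: measurable_funX.
    - exact: measurableT_comp.
    - by move=> w; rewrite exprn_even_ge0.
    - by apply: filterS SY => w /le_trans; apply; exact: ler_norm.
  rewrite unlock le_eqVlt; apply/orP; left; apply/eqP.
  apply: ae_eq_integral => //.
  - by apply/measurable_EFinP; exact: measurableT_comp.
  - exact/measurable_EFinP.
  apply: filterS SY => w /= Sw _; rewrite ger0_norm //.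
  by apply: le_trans Sw; rewrite exprn_even_ge0.
have p0 : p%:R != 0 :> R by rewrite pnatr_eq0 -lt0n ltnW.
have s0 : 0 <= \sum_k a k ^+ 2 by apply: sumr_ge0 => k _; exact: sqr_ge0.
rewrite unlock /=.
have -> : (\int[P]_x `|(S x)%:E| `^ p%:R = 'E_P[fun w => (S w ^+ p)%R])%E.
  rewrite unlock; apply: eq_integral => w _ /=.
  by rewrite powR_mulrn // -normrX ger0_norm // exprn_even_ge0.
apply: le_trans (gt0_ler_poweR _ _ _ ES) _; rewrite ?invr_ge0 ?ler0n //.
- by rewrite in_itv /= leey andbT expectation_ge0 // => w; rewrite exprn_even_ge0.
- by rewrite in_itv /= leey andbT lee_fin mulr_ge0 ?exprn_ge0.
rewrite poweR_EFin lee_fin powRM ?exprn_ge0 // /khintchine_const.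
(* Writing the sum of squares as the square of its root turns the q-th power into a p-th power,
   which the exponent 1/p cancels. *)
rewrite -[X in X ^+ q]sqr_sqrtr // -exprM mul2n -pq -powR_mulrn //.
by rewrite -powRrM mulfV // powRr1.
Qed.
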